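(* Let $Q_2\subset\mathbb{R}^n$ be a bounded full-dimensional polyhedron, let $\check x\in\mathbb{R}^n\setminus Q_2$ and $\widehat x\in Q_2$. Suppose that the secondary normalization guarantees the generation of facets, i.e. for every $x'\notin Q_2$ the secondary separation procedure called on $(Q_2,x')$ returns an inequality $\pi x\le\pi_0$ that is valid for $Q_2$, is strictly violated by $x'$, and defines a facet of $Q_2$. Then the iterative method for the Fenchel sub-problem (described in the context) terminates after finitely many iterations and returns a cut associated with the directional normalization toward $\widehat x$.
   Context: **Cuts.** A cut is an inequality $\pi x\le\pi_0$ valid for $Q_2$ (i.e. satisfied by all points of $Q_2$); it separates a point $y$ from $Q_2$ if $\pi y>\pi_0$. A point is said to be on the cut if it satisfies $\pi x=\pi_0$. **Directional normalization.** The Fenchel separation problem for $\check x$ with directional normalization toward $\widehat x$ is $$\max_{\pi,\pi_0}\{\pi\check x-\pi_0 : \pi x\le\pi_0\ \ \forall x\in Q_2,\ |\pi(\widehat x-\check x)|\le 1\}.$$ A cut associated with the directional normalization toward $\widehat x$ is, up to positive scaling, an optimal solution of this problem; equivalently, it is a cut $\pi x\le\pi_0$ valid for $Q_2$, separating $\check x$ from $Q_2$, whose hyperplane $\pi x=\pi_0$ contains the point where the segment from $\check x$ to $\widehat x$ meets the frontier of $Q_2$ (the point of $Q_2$ on this segment closest to $\check x$). **Iterative method.** Input: $Q_2$, $\check x$, $\widehat x$. 1. Set $x'=\check x$. 2. While $x'\notin Q_2$: call the secondary separation procedure (the Fenchel separation problem solved with some other fixed normalization, called the secondary normalization) on $(Q_2,x')$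 to obtain a cut $C$ separating $x'$ from $Q_2$; then replace $x'$ by the intersection point of the segment from $\check x$ to $\widehat x$ with the hyperplane of $C$. 3. Return the last cut $C$. *)

(* Defs.v *)
From mathcomp Require Import all_boot all_order all_algebra.
From mathcomp Require Import all_classical all_reals all_analysis.

Set Implicit Arguments.
Unset Strict Implicit.
Unset Printing Implicit Defensive.

Import Order.TTheory GRing.Theory Num.Theory.
Import numFieldNormedType.Exports.

Local Open Scope classical_set_scope.
Local Open Scope ring_scope.

(* Points of R^n are column vectors, normals of inequalities are row vectors. *)
Section Polyhedra.
Context {R : realType} {n : nat}.
Implicit Types (S Q : set 'cV[R]_n) (x y : 'cV[R]_n) (pi : 'rV[R]_n).

Definition is_polyhedron Q : Prop :=
  exists (m : nat) (A : 'M[R]_(m, n)) (b : 'cV[R]_m),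
    Q = [set x | forall i, (A *m x) i 0 <= b i 0].

Definition affinely_independent (k : nat) (p : 'I_k -> 'cV[R]_n) : Prop :=
  forall c : 'I_k -> R,
    \sum_i c i = 0 -> \sum_i c i *: p i = 0 -> forall i, c i = 0.

(* [S] has affine dimension [d]: the largest number of affinely independent
   points of [S] is [d.+1].  The empty set has no dimension in this sense. *)
Definition has_dim S (d : nat) : Prop :=
  (exists p : 'I_d.+1 -> 'cV[R]_n,
      (forall i, S (p i)) /\ affinely_independent p) /\
  (forall p : 'I_d.+2 -> 'cV[R]_n,
      (forall i, S (p i)) -> ~ affinely_independent p).

Definition full_dimensional S : Prop := has_dim S n.

Definition dotp pi x : R := (pi *m x) 0 0.

Definition segment x y : set 'cV[R]_n :=
  [set z | exists2 t : R, 0 <= t <= 1 & z = (1 - t) *: x + t *: y].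

(* The pair [C] stands for the inequality [dotp C.1 x <= C.2]. *)
Definition inequality : Type := ('rV[R]_n * R)%type.
Implicit Types C D : inequality.

Definition valid Q C : Prop := forall x, Q x -> dotp C.1 x <= C.2.

Definition violated_by x C : Prop := C.2 < dotp C.1 x.

Definition hyperplane C : set 'cV[R]_n := [set x | dotp C.1 x = C.2].

Definition facet_defining Q C : Prop :=
  valid Q C /\ exists d, has_dim Q d.+1 /\ has_dim (Q `&` hyperplane C) d.

(* [C] is an optimal solution of
   max { pi x - pi0 : pi y <= pi0 for all y in Q, (pi, pi0) in N },
   where [N] is the set of inequalities allowed by the normalization. *)
Definition fenchel_optimal Q (N : set inequality) x C : Prop :=
  [/\ valid Q C, N C &
      forall D, valid Q D -> N D -> dotp D.1 x - D.2 <= dotp C.1 x - C.2].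

Definition directional_normalization (xc xh : 'cV[R]_n) : set inequality :=
  [set C | `|dotp C.1 (xh - xc)| <= 1].

Definition directional_cut Q (xc xh : 'cV[R]_n) C : Prop :=
  exists2 l : R, 0 < l &
    fenchel_optimal Q (directional_normalization xc xh) xc (l *: C.1, l * C.2).

(* [iteration Q sep xc xh k x c]: after [k] passes through the body of the
   loop, the current point is [x] and the last cut obtained is [c] ([None]
   before the first pass).  The intersection point is specified rather than
   computed, so its existence is part of [terminates] below. *)
Inductive iteration Q (sep : 'cV[R]_n -> inequality) (xc xh : 'cV[R]_n) :
    nat -> 'cV[R]_n -> option inequality -> Prop :=
| iteration0 : iteration Q sep xc xh 0 xc None
| iterationS k x c y :
    iteration Q sep xc xh k x c ->
    ~ Q x ->
    (segment xc xh `&` hyperplane (sep x)) y ->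
    iteration Q sep xc xh k.+1 y (Some (sep x)).

(* The number of passes is bounded, and the loop never gets stuck: as long as
   its guard holds, the intersection point required by its body exists. *)
Definition terminates Q (sep : 'cV[R]_n -> inequality) (xc xh : 'cV[R]_n) :
    Prop :=
  (exists K : nat, forall k x c, iteration Q sep xc xh k x c -> (k <= K)%N) /\
  (forall k x c, iteration Q sep xc xh k x c -> ~ Q x ->
     exists y, (segment xc xh `&` hyperplane (sep x)) y).

Definition returns Q (sep : 'cV[R]_n -> inequality) (xc xh : 'cV[R]_n) C :
    Prop :=
  exists (k : nat) x, iteration Q sep xc xh k x (Some C) /\ Q x.

End Polyhedra.

Arguments inequality : clear implicits.

(* Main.v *)
Require Import Defs.
From mathcomp Require Import all_boot all_order all_algebra.
From mathcomp Require Import all_classical all_reals all_analysis.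
From mathcomp Require Import ring lra.
Import Order.TTheory GRing.Theory Num.Theory.
Import numFieldNormedType.Exports.
Local Open Scope classical_set_scope.
Local Open Scope ring_scope.

(** Write [Q2] as the solution set of [m] rows.  Suppose that [x] is not in [Q2]
    and that the cut [C] returned for [x] is facet-defining.  Let [p] be the
    barycenter of affinely independent points spanning the facet.  Every point
    of the segment from [p] to [x] other than [p] violates [C], hence lies
    outside [Q2], so that some row is tight at [p] and violated at [x].  This
    row is tight on the spanning points, hence on the whole hyperplane of [C].
    The next iterate thus satisfies it, while moving toward [xh] never makes a
    satisfied row violated: the number of violated rows decreases strictly at
    each pass.  For the last cut [C], the last iterate is [x = xc + t (xh - xc)]
    in [Q2], so [t] bounds the objective of the directional problem, and [C],
    scaled so that [C.1 (xc - xh) = 1], attains it. *)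

(** * Linearity of [dotp] *)

Section DotProduct.
Context {R : realType} {n : nat}.
Implicit Types (x y : 'cV[R]_n) (pi : 'rV[R]_n).

Lemma dotpD pi x y : dotp pi (x + y) = dotp pi x + dotp pi y.
Proof. by rewrite /dotp mulmxDr mxE. Qed.

Lemma dotpZ pi (a : R) x : dotp pi (a *: x) = a * dotp pi x.
Proof. by rewrite /dotp -scalemxAr mxE. Qed.

Lemma dotpB pi x y : dotp pi (x - y) = dotp pi x - dotp pi y.
Proof. by rewrite -scaleN1r dotpD dotpZ mulN1r. Qed.

Lemma dotp_sum pi k (p : 'I_k -> 'cV[R]_n) :
  dotp pi (\sum_i p i) = \sum_i dotp pi (p i).
Proof. by rewrite /dotp mulmx_sumr summxE. Qed.

Lemma dotpZl (a : R) pi x : dotp (a *: pi) x = a * dotp pi x.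
Proof. by rewrite /dotp -scalemxAl mxE. Qed.

Lemma dotp0l x : dotp 0 x = 0.
Proof. by rewrite /dotp mul0mx mxE. Qed.

Lemma dotp_row m (A : 'M[R]_(m, n)) i x : dotp (row i A) x = (A *m x) i 0.
Proof. by rewrite /dotp -row_mul mxE. Qed.

End DotProduct.

(** * Positions and inequalities along a segment *)

Section Segments.
Context {R : realType} {n : nat}.
Implicit Types (u v x y z : 'cV[R]_n) (C : inequality R n).

Lemma segment_left u v : segment u v u.
Proof.
exists 0; first by rewrite lexx ler01.
by rewrite subr0 scale1r scale0r addr0.
Qed.

Lemma segment_sub u v x : segment u v x -> segment x v `<=` segment u v.
Proof.
move=> [t /andP[t0 t1] ->] y [s /andP[s0 s1] ->].
(* This is [1 - (1 - t) * (1 - s)]: the weights of the left endpoints multiply. *)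
exists (t + s - t * s); first by apply/andP; split; nra.
by apply/matrixP=> i j; rewrite !mxE; ring.
Qed.

Lemma segment_total u v x y :
  segment u v x -> segment u v y -> segment x v y \/ segment y v x.
Proof.
have aux (s t : R) : 0 <= s <= 1 -> 0 <= t <= 1 -> s <= t ->
    segment ((1 - s) *: u + s *: v) v ((1 - t) *: u + t *: v).
  move=> /andP[s0 s1] /andP[t0 t1] st.
  have [s_eq1|s_neq1] := eqVneq s 1.
    have -> : t = s by apply/le_anti/andP; split=> //; rewrite s_eq1.
    exact: segment_left.
  have s_lt1 : 0 < 1 - s by rewrite subr_gt0 lt_neqAle s_neq1.
  exists ((t - s) / (1 - s)).
    rewrite ler_pdivlMr // ler_pdivrMr // mul0r mul1r; apply/andP; split; lra.
  apply/matrixP=> i j; rewrite !mxE; field.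
  exact: lt0r_neq0.
move=> [s s01 ->] [t t01 ->].
by have [st|/ltW ts] := leP s t; [left|right]; exact: aux.
Qed.

(** A half-space is convex: if [u] satisfied [C] as [v] does, so would [x]. *)
Lemma violated_by_segment u v x C :
  segment u v x -> violated_by x C -> dotp C.1 v <= C.2 -> violated_by u C.
Proof.
move=> [t /andP[t0 t1] ->]; rewrite /violated_by dotpD !dotpZ => Cx Cv.
rewrite ltNge; apply/negP=> Cu; nra.
Qed.

Lemma segment_meets_hyperplane u v C :
  violated_by u C -> dotp C.1 v <= C.2 ->
  exists y, (segment u v `&` hyperplane C) y.
Proof.
rewrite /violated_by => Cu Cv.
have uv_gt0 : 0 < dotp C.1 u - dotp C.1 v by lra.
pose t := (dotp C.1 u - C.2) / (dotp C.1 u - dotp C.1 v).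
exists ((1 - t) *: u + t *: v); split.
  exists t => //; rewrite /t ler_pdivlMr // ler_pdivrMr // mul0r mul1r.
  by apply/andP; split; lra.
rewrite /hyperplane /= dotpD !dotpZ /t; field.
exact: lt0r_neq0.
Qed.

End Segments.

(** * Affine independence and dimension *)

Section Dimension.
Context {R : realType} {n : nat}.
Implicit Types (S : set 'cV[R]_n) (C D : inequality R n).

Lemma affinely_independent_widen k l (kl : (k <= l)%N) (p : 'I_l -> 'cV[R]_n) :
  affinely_independent p -> affinely_independent (p \o widen_ord kl).
Proof.
move=> p_indep c c0 cp0 i.
(* Extension by zero: [insub] fails from index [k] on. *)
pose c' (j : 'I_l) : R := oapp c 0 (insub (val j)).
have c'E j : c' (widen_ord kl j) = c j by rewrite /c' /= valK.
have sumE (V : lmodType R) (q : 'I_l -> V) :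
    \sum_j c' j *: q j = \sum_j c j *: q (widen_ord kl j).
  rewrite (bigID (fun j : 'I_l => (j < k)%N)) /= [X in _ + X]big1 ?addr0.
    by rewrite (big_ord_narrow kl); apply: eq_bigr => j _; rewrite c'E.
  by move=> j jk; rewrite /c' insubN ?scale0r.
rewrite -c'E; apply: p_indep; last by rewrite sumE.
(* The constant family 1 turns [sumE] into an equality of coefficient sums. *)
have := sumE R^o (fun=> 1).
under eq_bigr do rewrite /GRing.scale /= mulr1.
under [RHS]eq_bigr do rewrite /GRing.scale /= mulr1.
by move=> ->.
Qed.

(** Used to see that a facet of a full-dimensional polyhedron carries at least [n] affinely
    independent points. *)
Lemma has_dim_leq S d e : has_dim S d -> has_dim S e -> (d <= e)%N.
Proof.
move=> [[p [Sp p_indep]] _] [_ noS]; rewrite leqNgt; apply/negP=> ed.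
have ed2 : (e.+2 <= d.+1)%N by [].
exact: (noS _ (fun i => Sp (widen_ord ed2 i)))
  (affinely_independent_widen _ _ ed2 _ p_indep).
Qed.

(* The inequalities that are tight at all the [p j] form, in homogeneous
   coordinates, the kernel of a matrix of rank [k >= n] with [n + 1] columns,
   hence a space of dimension at most 1. *)
Lemma hyperplane_sub k (p : 'I_k -> 'cV[R]_n) C D :
  affinely_independent p -> (n <= k)%N -> C.1 != 0 ->
  (forall j, hyperplane C (p j)) -> (forall j, hyperplane D (p j)) ->
  hyperplane C `<=` hyperplane D.
Proof.
move=> p_indep nk C_neq0 Cp Dp.
(* Column [j] of [M] is [p j] preceded by a coordinate 1, so that [u E] sends it to
   [dotp E.1 (p j) - E.2]. *)
pose M : 'M[R]_(1 + n, k) := \matrix_(i, j) col_mx 1%:M (p j) i 0.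
pose u E : 'rV[R]_(1 + n) := row_mx (- E.2)%:M E.1.
have col_M j : col j M = col_mx 1%:M (p j).
  by apply/matrixP=> i l; rewrite !mxE !ord1.
have uM E : (forall j, hyperplane E (p j)) -> (u E <= kermx M)%MS.
  move=> Ep; apply/sub_kermxP/matrixP=> i j; rewrite [RHS]mxE.
  have -> : (u E *m M) i j = (u E *m col j M) i 0.
    by rewrite colE mulmxA -colE [RHS]mxE.
  rewrite col_M mul_row_col mulmx1 mxE ord1 -/(dotp E.1 (p j)) Ep.
  by rewrite mxE /= mulr1n addNr.
have M_rank : \rank M = k.
  rewrite -mxrank_tr; apply/eqP; rewrite -/(row_free _).
  apply: inj_row_free => c cM0.
  have cM i : \sum_j c 0 j * M i j = 0.
    have -> : \sum_j c 0 j * M i j = (c *m M^T) 0 i.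
      by rewrite mxE; apply: eq_bigr => j _; rewrite [M^T _ _]mxE.
    by rewrite cM0 mxE.
  (* The first row of [M] gives the zero coefficient sum, the others the zero combination. *)
  apply/rowP=> j; rewrite [RHS]mxE; apply: p_indep.
    rewrite -[RHS](cM (lshift n 0)); apply: eq_bigr => i _.
    by rewrite mxE col_mxEu mxE mulr1.
  apply/matrixP=> i l; rewrite ord1 [RHS]mxE summxE -[RHS](cM (rshift 1 i)).
  by apply: eq_bigr => h _; rewrite mxE [M _ _]mxE col_mxEd.
have uC_rank : \rank (u C) = 1%N.
  apply/eqP; rewrite eqn_leq rank_leq_row lt0n mxrank_eq0.
  apply: contraNneq C_neq0 => uC0.
  by rewrite -[C.1](row_mxKr (- C.2)%:M) -/(u C) uC0 linear0.
have ker_u : (kermx M <= u C)%MS.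
  rewrite -(geq_leqif (mxrank_leqif_sup (uM _ Cp))) uC_rank mxrank_ker M_rank.
  by rewrite leq_subLR addn1 ltnS.
have /sub_rVP[a uDC] := submx_trans (uM _ Dp) ker_u.
have [E2 E1] : D.2 = a * C.2 /\ D.1 = a *: C.1.
  move: uDC; rewrite /u scale_row_mx => /eq_row_mx[/matrixP/(_ 0 0)].
  by rewrite !mxE /= !mulr1n mulrN => /oppr_inj.
by move=> x; rewrite /hyperplane /= E1 E2 dotpZl => ->.
Qed.

End Dimension.

(** * Rows that define a facet *)

Section Facets.
Context {R : realType} {n m : nat}.
Variables (A : 'M[R]_(m, n)) (b : 'cV[R]_m).
Implicit Types (x p : 'cV[R]_n) (C : inequality R n).

Let Q : set 'cV[R]_n := [set x | forall i, (A *m x) i 0 <= b i 0].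

(** Otherwise a short move from [p] towards [x] stays in [Q], yet it violates [C] at once. *)
Lemma exists_tight_violated_row p x C :
  valid Q C -> Q p -> hyperplane C p -> violated_by x C ->
  exists i, (A *m p) i 0 = b i 0 /\ b i 0 < (A *m x) i 0.
Proof.
move=> CQ Qp Cp Cx; apply: contrapT => no_row.
pose f i (y : 'cV[R]_n) : R := (A *m y) i 0.
have fE i y : f i y = dotp (row i A) y by rewrite dotp_row.
(* The fraction of the way from [p] to [x] at which row [i] becomes tight, or 1 if [x] satisfies
   it. *)
pose step i : R :=
  if b i 0 < f i x then (b i 0 - f i p) / (f i x - f i p) else 1.
have step_gt0 i : 0 < step i.
  rewrite /step; case: ifPn => [xi|_]; last exact: ltr01.
  have pi : f i p < b i 0.
    rewrite lt_neqAle (Qp i) andbT; apply/negP=> /eqP pi.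
    by apply: no_row; exists i.
  by apply: divr_gt0; lra.
pose t := \big[Order.min/1]_i step i.
have t_gt0 : 0 < t.
  by apply: (big_ind (fun a : R => 0 < a)) => // a c a0 c0; rewrite lt_min a0.
have t_le1 : t <= 1 by exact: bigmin_le_id.
have t_step i : t <= step i by exact: bigmin_le.
have Qy : Q ((1 - t) *: p + t *: x).
  move=> i; rewrite -/(f i _) fE dotpD !dotpZ -!fE.
  have pi : f i p <= b i 0 := Qp i.
  have := t_step i; rewrite /step; case: ifPn => [xi|].
    rewrite ler_pdivlMr; lra.
  rewrite -leNgt => xi _; nra.
have := CQ _ Qy; rewrite dotpD !dotpZ; move: Cx Cp.
rewrite /violated_by /hyperplane /= => Cx Cp; nra.
Qed.

Lemma facet_violated_row x C :
  full_dimensional Q -> facet_defining Q C -> violated_by x C ->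
  exists i, b i 0 < (A *m x) i 0 /\
    hyperplane C `<=` hyperplane (row i A, b i 0).
Proof.
move=> Q_dim [CQ [d [Qd [[p [Fp p_indep]] _]]]] Cx.
have N_gt0 : 0 < d.+1%:R :> R by rewrite ltr0n.
pose g := d.+1%:R^-1 *: \sum_j p j.
have gE pi : dotp pi g = d.+1%:R^-1 * \sum_j dotp pi (p j).
  by rewrite dotpZ dotp_sum.
have mean (a : R) : d.+1%:R^-1 * \sum_(j < d.+1) a = a.
  by rewrite sumr_const card_ord -[a *+ _]mulr_natl mulKf // gt_eqF.
have Qg : Q g.
  move=> i; rewrite -dotp_row gE -[leRHS]mean ler_pM2l ?invr_gt0 //.
  by apply: ler_sum => j _; rewrite dotp_row; exact: (Fp j).1.
have Cg : hyperplane C g.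
  rewrite /hyperplane /= gE -[RHS]mean; congr (_ * _).
  by apply: eq_bigr => j _; exact: (Fp j).2.
have [i [gi xi]] := exists_tight_violated_row g x C CQ Qg Cg Cx.
exists i; split => //; apply: (hyperplane_sub _ p) => //.
- exact: has_dim_leq Q_dim Qd.
(* If [C.1 = 0], then [g] forces [C.2 = 0], and [x] would violate [0 <= 0]. *)
- apply: contraTneq Cx => C0; move: Cg.
  by rewrite /violated_by /hyperplane /= C0 !dotp0l => <-; rewrite ltxx.
- by move=> j; exact: (Fp j).2.
(* Nonnegative slacks whose mean, the slack at [g], is zero all vanish. *)
have slack_ge0 j : true -> 0 <= b i 0 - dotp (row i A) (p j).
  by move=> _; rewrite subr_ge0 dotp_row; exact: (Fp j).1.
have slack_sum : \sum_j (b i 0 - dotp (row i A) (p j)) = 0.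
  apply: (mulfI (invr_neq0 (lt0r_neq0 N_gt0))).
  by rewrite sumrB mulrBr mean -gE dotp_row gi subrr mulr0.
move=> j; apply/esym/eqP; rewrite -subr_eq0; apply/eqP.
exact: (psumr_eq0P slack_ge0 slack_sum).
Qed.

End Facets.

(** * Runs of the iterative method *)

Section Iteration.
Context {R : realType} {n : nat}.
Variables (Q : set 'cV[R]_n) (sep : 'cV[R]_n -> inequality R n).
Variables (xc xh : 'cV[R]_n).
Hypothesis Qxh : Q xh.
Hypothesis sep_valid : forall x, ~ Q x -> valid Q (sep x).
Hypothesis sep_violated : forall x, ~ Q x -> violated_by x (sep x).

Lemma iteration_segment k x c :
  iteration Q sep xc xh k x c -> segment xc xh x.
Proof. by case=> [|{}k z c' y _ _ []] //; exact: segment_left. Qed.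

Lemma iteration_progress k x c : iteration Q sep xc xh k x c -> ~ Q x ->
  exists y, (segment xc xh `&` hyperplane (sep x)) y.
Proof.
move=> it_x nQx.
have [y [xy Cy]] := segment_meets_hyperplane _ _ _ (sep_violated _ nQx)
  (sep_valid _ nQx _ Qxh).
by exists y; split=> //; exact: segment_sub (iteration_segment _ _ _ it_x) _ xy.
Qed.

(** If [y] came before [x], it would violate [sep x], on which it lies. *)
Lemma step_toward x y : ~ Q x -> segment xc xh x ->
  (segment xc xh `&` hyperplane (sep x)) y -> segment x xh y.
Proof.
move=> nQx sx [sy Cy]; have [//|yx] := segment_total _ _ _ _ sx sy.
have := violated_by_segment _ _ _ _ yx (sep_violated _ nQx)
  (sep_valid _ nQx _ Qxh).
by rewrite /violated_by Cy ltxx.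
Qed.

(** A run that never enters [Q] can always be prolonged, beyond any bound [K]. *)
Lemma terminates_returns : ~ Q xc -> terminates Q sep xc xh ->
  exists C, returns Q sep xc xh C.
Proof.
move=> nQxc [[K it_le] progress]; apply: contrapT => no_ret.
have it_all k : exists x c, iteration Q sep xc xh k x c /\ ~ Q x.
  elim: k => [|k [x [c [it_x nQx]]]]; first by exists xc, None; split=> //; left.
  have [y xy] := progress _ _ _ it_x nQx.
  have it_y := iterationS it_x nQx xy.
  exists y, (Some (sep x)); split=> // Qy.
  by apply: no_ret; exists (sep x), k.+1, y.
have [x [c [it_x _]]] := it_all K.+1.
by have := it_le _ _ _ it_x; rewrite ltnn.
Qed.

Lemma returns_directional_cut C :
  returns Q sep xc xh C -> directional_cut Q xc xh C.
Proof.
move=> [k [y [it_y Qy]]].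
have [x [it_x nQx [[t /andP[t0 t1] yE] Cy] CE]] : exists x,
    [/\ segment xc xh x, ~ Q x, (segment xc xh `&` hyperplane (sep x)) y &
        C = sep x].
  move: Qy; inversion it_y; subst=> Qy; exists x; split=> //.
  by apply: iteration_segment; eassumption.
have CQ := sep_valid _ nQx; have Cx := sep_violated _ nQx.
rewrite -CE in CQ Cx Cy.
(* The cut was made for [x], but it separates [xc] too, since [x] lies between [xc] and [xh]. *)
have := violated_by_segment _ _ _ _ it_x Cx (CQ _ Qxh).
rewrite /violated_by => Cxc.
have Cy' : (1 - t) * dotp C.1 xc + t * dotp C.1 xh = C.2.
  by rewrite -Cy yE dotpD !dotpZ.
have gap_gt0 : 0 < dotp C.1 xc - dotp C.1 xh.
  by rewrite ltNge; apply/negP=> gap; nra.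
exists (dotp C.1 xc - dotp C.1 xh)^-1; first by rewrite invr_gt0.
split=> /=.
- by move=> z Qz /=; rewrite dotpZl ler_pM2l ?invr_gt0 //; exact: CQ.
- rewrite /directional_normalization /= dotpZl dotpB.
  rewrite -(opprB (dotp C.1 xc)) mulrN.
  by rewrite mulVf ?normrN ?normr1 // lt0r_neq0.
move=> D DQ; rewrite /directional_normalization /= dotpB ler_norml => /andP[D1 _].
have -> : dotp ((dotp C.1 xc - dotp C.1 xh)^-1 *: C.1) xc -
    (dotp C.1 xc - dotp C.1 xh)^-1 * C.2 = t.
  by rewrite dotpZl -Cy'; field; exact: lt0r_neq0.
(* Validity of [D] at [y] bounds its objective by [t * dotp D.1 (xc - xh)], which is at most [t]. *)
have := DQ _ Qy; rewrite yE dotpD !dotpZ => Dy; nra.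
Qed.

End Iteration.

(** Each pass adds one to [k] and repairs at least one row without breaking any. *)
Lemma iteration_violated_rows (R : realType) (n m : nat) (A : 'M[R]_(m, n))
    (b : 'cV[R]_m) (Q := [set x | forall i, (A *m x) i 0 <= b i 0])
    (sep : 'cV[R]_n -> inequality R n) (xc xh : 'cV[R]_n) :
  full_dimensional Q -> Q xh ->
  (forall x, ~ Q x -> violated_by x (sep x)) ->
  (forall x, ~ Q x -> facet_defining Q (sep x)) ->
  forall k x c, iteration Q sep xc xh k x c ->
    (k + #|[pred i | (b i 0 < (A *m x) i 0)%R]| <= m)%N.
Proof.
move=> Q_dim Qxh sep_violated sep_facet k x c.
elim=> {k x c} [|k x c y it_x IH nQx xy].
  by rewrite add0n -[leqRHS]card_ord max_card.
apply: leq_trans IH; rewrite addSn -addnS leq_add2l.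
have [i [xi CD]] :=
  facet_violated_row A b x _ Q_dim (sep_facet _ nQx) (sep_violated _ nQx).
have sep_valid z (nQz : ~ Q z) : valid Q (sep z) := (sep_facet z nQz).1.
have x_xh : segment x xh y :=
  step_toward _ _ _ _ Qxh sep_valid sep_violated _ _ nQx
    (iteration_segment _ _ _ _ _ _ _ it_x) xy.
apply/proper_card/properP; split.
  apply/fintype.subsetP=> j; rewrite !inE -!dotp_row => yj.
  apply: (violated_by_segment _ _ _ (row j A, b j 0) x_xh yj).
  by rewrite /= dotp_row.
exists i; rewrite !inE // -dotp_row.
by have /= -> := CD _ xy.2; rewrite ltxx.
Qed.

Theorem theorem2 (R : realType) (n : nat) (Q2 : set 'cV[R]_n)
    (xc xh : 'cV[R]_n)
    (secondary_normalization : 'cV[R]_n -> set (inequality R n))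
    (sep : 'cV[R]_n -> inequality R n) :
  is_polyhedron Q2 ->
  bounded_set Q2 ->
  full_dimensional Q2 ->
  ~ Q2 xc ->
  Q2 xh ->
  (forall x, ~ Q2 x ->
     fenchel_optimal Q2 (secondary_normalization x) x (sep x)) ->
  (forall x, ~ Q2 x ->
     [/\ valid Q2 (sep x), violated_by x (sep x) &
         facet_defining Q2 (sep x)]) ->
  [/\ terminates Q2 sep xc xh,
      (exists C, returns Q2 sep xc xh C) &
      (forall C, returns Q2 sep xc xh C -> directional_cut Q2 xc xh C)].
Proof.
move=> [m [A [b Q2E]]] _ Q2_dim nQ2xc Q2xh _ sepP.
have sep_valid x : ~ Q2 x -> valid Q2 (sep x) by case/sepP.
have sep_violated x : ~ Q2 x -> violated_by x (sep x) by case/sepP.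
have sep_facet x : ~ Q2 x -> facet_defining Q2 (sep x) by case/sepP.
have term : terminates Q2 sep xc xh.
  split; last exact: iteration_progress.
  exists m => k x c it_x; apply: leq_trans (leq_addr _ _) _.
  rewrite Q2E in Q2_dim Q2xh sep_violated sep_facet it_x.
  exact: iteration_violated_rows Q2_dim Q2xh sep_violated sep_facet _ _ _ it_x.
split=> //; first exact: terminates_returns.
by move=> C; exact: returns_directional_cut.
Qed.
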